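(* Let $\mathbf{V}$ be a pseudovariety and let $\Lambda$ be a modulus. Then $$\mathbf{V} \subseteq \mathrm{pt}(\Lambda) \quad \Longleftrightarrow \quad \mathcal{C}_{\Lambda}^{\infty} \le \mathrm{PL}_{\mathbf{V}},$$ where $\mathcal{C}_\Lambda^\infty$ is the monad completion of the complex functor $\mathcal{C}_\Lambda$ induced by $\Lambda$.
   Context: $\mathsf{FSgp}$ is the category of finite semigroups (the empty semigroup is allowed) and homomorphisms. For a finite semigroup $S$, $\mathcal{P}(S)$ is the semigroup of non-empty subsets of $S$ under $XY = \{xy : x\in X, y\in Y\}$, and $\mathrm{sing}(S) \subseteq \mathcal{P}(S)$ is the subsemigroup of singletons. A homomorphism $\varphi : S \to T$ extends to $\dot\varphi : \mathcal{P}(S) \to \mathcal{P}(T)$, $X \mapsto \{\varphi(x) : x \in X\}$. For $\mathcal{X}\subseteq\mathcal{P}(S)$, $\downarrow\!\mathcal{X}$ is the set of $Y \in \mathcal{P}(S)$ with $Y \subseteq X$ for some $X \in \mathcal{X}$. An $S$-complex is a subsemigroup of $\mathcal{P}(S)$ which contains $\mathrm{sing}(S)$ and is closed under taking non-empty subsets of its members. A complex functor is a functor $\mathcal{C} : \mathsf{FSgp} \to \mathsf{FSgp}$ such that $\mathcal{C}(S)$ is an $S$-complex for every $S$, $\mathcal{C}(\varphi)$ is the restriction $\dot\varphi : \mathcal{C}(S) \to \mathcal{C}(T)$ for each $\varphi : S\to T$, and $\mathcal{C}$ preserves surjective homomorphisms. Complex functors are ordered by $\mathcal{C}_1 \le \mathcal{C}_2$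 iff $\mathcal{C}_1(S) \subseteq \mathcal{C}_2(S)$ for all $S$. Monad completion: for a complex functor $\mathcal{C}$ put $\mathcal{C}^{[0]}(S) = \mathrm{sing}(S)$, $\mathcal{C}^{[n+1]}(S) = \downarrow\!\{ \bigcup \mathcal{A} : \mathcal{A} \in \mathcal{C}(\mathcal{C}^{[n]}(S)) \}$, and $\mathcal{C}^{\infty}(S) = \bigcup_n \mathcal{C}^{[n]}(S)$ (an increasing union). A modulus $\Lambda$ is a rule assigning to each finite semigroup $S$ a (possibly empty) set $\Lambda_S \subseteq \mathcal{P}(S)$ such that: (i) for every homomorphism $\varphi : S \to T$ and $X \in \Lambda_S$ there is $\widetilde{X} \in \Lambda_T$ with $\dot\varphi(X) \subseteq \widetilde{X}$; (ii) for every surjective homomorphism $\varphi : S \to T$ and $Y \in \Lambda_T$ there is $\widetilde{Y} \in \Lambda_S$ with $\dot\varphi(\widetilde{Y}) = Y$. The set of points of $\Lambda$ is $\mathrm{pt}(\Lambda) = \{ S \in \mathsf{FSgp} : \Lambda_S \subseteq \mathrm{sing}(S) \}$. The complex functor induced by $\Lambda$ is $\mathcal{C}_\Lambda(S) = \downarrow\!\langle \Lambda_S \cup \mathrm{sing}(S)\rangle$, where $\langle - \rangle$ denotes the generated subsemigroup of $\mathcal{P}(S)$. A relational morphism $\rho$ from $S$ to $T$ is determined by its graph $\Gamma(S,\rho,T)$, a subsemigroup of $S \times T$ projecting onto $S$; for $t\in T$, $\rho^{-1}(t) = \{ s : (s,t) \in \Gamma(S,\rho,T)\}$; the nerve is $\mathrm{Nrv}(S,\rho,T)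 = \{ X \in \mathcal{P}(S) : X \subseteq \rho^{-1}(t) \text{ for some } t \in T \}$. A pseudovariety is a class of finite semigroups closed under subsemigroups, homomorphic images and finite products. For a pseudovariety $\mathbf{V}$, $\mathrm{PL}_{\mathbf{V}}$ is the complex functor given by $\mathrm{PL}_{\mathbf{V}}(S) = \bigcap \mathrm{Nrv}(S,\rho,V)$, the intersection ranging over all relational morphisms $\rho$ from $S$ to some $V\in \mathbf{V}$. *)

(* Defs.v *)
From HB Require Import structures.
From mathcomp Require Import all_boot.
From mathcomp Require Import boolp.

Set Implicit Arguments.
Unset Strict Implicit.
Unset Printing Implicit Defensive.

Local Open Scope group_scope.

(* [finSemigroupType] is the class of objects of FSgp (the carrier may be     *)
(* empty); its morphisms are the [{multiplicative S -> T}] of [monoid.v].     *)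
#[short(type="finSemigroupType")]
HB.structure Definition FinSemigroup := {S of Semigroup S & Finite S}.

HB.instance Definition _ (S T : finSemigroupType) := Semigroup.on (S * T)%type.

Definition surjective (A B : Type) (f : A -> B) : Prop :=
  forall y, exists x, f x = y.

Record subsemigroup (S : finSemigroupType) := Subsemigroup {
  subsg_set :> {set S};
  subsgP : mulg_closed subsg_set
}.

Definition subsgT (S : finSemigroupType) (H : subsemigroup S) : predArgType :=
  {x : S | x \in subsg_set H}.

HB.instance Definition _ (S : finSemigroupType) (H : subsemigroup S) :=
  SubChoice.on (subsgT H).
HB.instance Definition _ (S : finSemigroupType) (H : subsemigroup S) :=
  Finite.on (subsgT H).
HB.instance Definition _ (S : finSemigroupType) (H : subsemigroup S) :=
  SubChoice_isSubSemigroup.Build S (fun x => x \in subsg_set H) (subsgT H)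
    (@subsgP S H).

Definition prodsg (I : finType) (F : I -> finSemigroupType) : predArgType :=
  {dffun forall i : I, F i}.

HB.instance Definition _ (I : finType) (F : I -> finSemigroupType) :=
  Finite.on (prodsg F).

Definition prodsg_mul (I : finType) (F : I -> finSemigroupType)
  (f g : prodsg F) : prodsg F := [ffun i => f i * g i].

Lemma prodsg_mulA (I : finType) (F : I -> finSemigroupType) :
  associative (@prodsg_mul I F).
Proof. by move=> f g h; apply/ffunP => i; rewrite !ffunE mulgA. Qed.

HB.instance Definition _ (I : finType) (F : I -> finSemigroupType) :=
  isSemigroup.Build (prodsg F) (@prodsg_mulA I F).

Definition generated (S : finSemigroupType) (A : {set S}) : {set S} :=
  \bigcap_(B : {set S} |
     (A \subset B) && [forall x in B, forall y in B, x * y \in B]) B.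

Lemma generated_min (S : finSemigroupType) (A B : {set S}) :
  A \subset B -> mulg_closed B -> generated A \subset B.
Proof.
move=> sAB cB; apply: bigcap_inf; rewrite sAB /=.
by apply/forall_inP => x xB; apply/forall_inP => y yB; apply: cB.
Qed.

Lemma sub_generated (S : finSemigroupType) (A : {set S}) :
  A \subset generated A.
Proof. by apply/bigcapsP => B /andP[]. Qed.

Lemma generated_closed (S : finSemigroupType) (A : {set S}) :
  mulg_closed (generated A).
Proof.
move=> x y /bigcapP xA /bigcapP yA; apply/bigcapP => B hB.
have /andP[_ /forall_inP cB] := hB.
by move/forall_inP: (cB _ (xA _ hB)); apply; apply: yA.
Qed.

(* The semigroup P(S) of non-empty subsets.                                   *)
Record pow (S : finSemigroupType) := Pow {
  pow_set :> {set S};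
  pow_neq0 : pow_set != set0
}.

HB.instance Definition _ (S : finSemigroupType) := [isSub for @pow_set S].
HB.instance Definition _ (S : finSemigroupType) := [Finite of pow S by <:].

Lemma powE (S : finSemigroupType) (X Y : pow S) :
  (X : {set S}) = Y -> X = Y.
Proof. exact: val_inj. Qed.

Lemma pow_mul_neq0 (S : finSemigroupType) (X Y : pow S) :
  [set x * y | x in (X : {set S}), y in (Y : {set S})] != set0.
Proof.
have /set0Pn[x xX] := pow_neq0 X; have /set0Pn[y yY] := pow_neq0 Y.
by apply/set0Pn; exists (x * y); apply: imset2_f.
Qed.

Definition pow_mul (S : finSemigroupType) (X Y : pow S) : pow S :=
  Pow (pow_mul_neq0 X Y).

Lemma pow_mulA (S : finSemigroupType) : associative (@pow_mul S).
Proof.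
move=> X Y Z; apply: powE; apply/setP => u; apply/imset2P/imset2P => /=.
  case=> x v xX /imset2P[y z yY zZ ->] ->.
  by exists (x * y) z => //; [apply: imset2_f | rewrite mulgA].
case=> v z /imset2P[x y xX yY ->] zZ ->.
by exists x (y * z) => //; [apply: imset2_f | rewrite mulgA].
Qed.

HB.instance Definition _ (S : finSemigroupType) :=
  isSemigroup.Build (pow S) (@pow_mulA S).

Lemma in_pow_mul (S : finSemigroupType) (X Y : pow S) (x y : S) :
  x \in (X : {set S}) -> y \in (Y : {set S}) -> x * y \in (X * Y : {set S}).
Proof. exact: imset2_f. Qed.

Lemma pow_mulP (S : finSemigroupType) (X Y : pow S) (u : S) :
  reflect (exists x y, [/\ x \in (X : {set S}), y \in (Y : {set S}) & u = x * y])
          (u \in (X * Y : {set S})).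
Proof.
apply: (iffP imset2P) => [[x y xX yY ->]|[x [y [xX yY ->]]]].
  by exists x, y.
by exists x y.
Qed.

Lemma pow_map_neq0 (S T : finSemigroupType) (f : S -> T) (X : pow S) :
  [set f x | x in (X : {set S})] != set0.
Proof.
have /set0Pn[x xX] := pow_neq0 X.
by apply/set0Pn; exists (f x); apply: imset_f.
Qed.

Definition pow_map (S T : finSemigroupType) (f : S -> T) (X : pow S) : pow T :=
  Pow (pow_map_neq0 f X).

Lemma pow_map_mul (S T : finSemigroupType) (f : {multiplicative S -> T}) :
  {morph pow_map f : X Y / X * Y}.
Proof.
move=> X Y; apply: powE; apply/setP => u; apply/imsetP/pow_mulP => /=.
  case=> _ /pow_mulP[x [y [xX yY ->]]] ->.
  by exists (f x), (f y); rewrite !imset_f // gmulfM.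
case=> _ [_ [/imsetP[x xX ->] /imsetP[y yY ->] ->]].
by exists (x * y); rewrite ?in_pow_mul // gmulfM.
Qed.

HB.instance Definition _ (S T : finSemigroupType)
  (f : {multiplicative S -> T}) :=
  isMultiplicative.Build (pow S) (pow T) (pow_map f) (pow_map_mul f).

Lemma pow1_neq0 (S : finSemigroupType) (x : S) : [set x] != set0.
Proof. by apply/set0Pn; exists x; rewrite inE. Qed.

Definition pow1 (S : finSemigroupType) (x : S) : pow S := Pow (pow1_neq0 x).

Definition sing (S : finSemigroupType) : {set pow S} := [set pow1 x | x : S].

Lemma in_sing (S : finSemigroupType) (x : S) : pow1 x \in sing S.
Proof. exact: imset_f. Qed.

Lemma pow1M (S : finSemigroupType) (x y : S) : pow1 x * pow1 y = pow1 (x * y).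
Proof.
apply: powE; apply/setP => u; apply/pow_mulP/set1P => /=.
  by case=> _ [_ [/set1P-> /set1P-> ->]].
by move=> ->; exists x, y; rewrite !inE.
Qed.

Lemma pow_map1 (S T : finSemigroupType) (f : S -> T) (x : S) :
  pow_map f (pow1 x) = pow1 (f x).
Proof. by apply: powE; rewrite /= imset_set1. Qed.

Definition down (S : finSemigroupType) (D : {set pow S}) : {set pow S} :=
  [set Y : pow S | [exists X in D, (Y : {set S}) \subset (X : {set S})]].

Lemma downP (S : finSemigroupType) (D : {set pow S}) (Y : pow S) :
  reflect (exists2 X, X \in D & (Y : {set S}) \subset (X : {set S}))
          (Y \in down D).
Proof. by rewrite inE; apply: exists_inP. Qed.

Lemma sub_down (S : finSemigroupType) (D : {set pow S}) : D \subset down D.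
Proof. by apply/subsetP => X XD; apply/downP; exists X. Qed.

Record is_complex (S : finSemigroupType) (K : {set pow S}) : Prop := IsComplex {
  complex_closed : mulg_closed K;
  complex_sing : sing S \subset K;
  complex_down : forall X Y : pow S,
    X \in K -> (Y : {set S}) \subset (X : {set S}) -> Y \in K
}.

Record complex (S : finSemigroupType) := Complex {
  complex_set :> {set pow S};
  complexP : is_complex complex_set
}.

Definition complex_subsg (S : finSemigroupType) (K : complex S) :
  subsemigroup (pow S) := Subsemigroup (complex_closed (complexP K)).

Definition complexT (S : finSemigroupType) (K : complex S) : finSemigroupType :=
  subsgT (complex_subsg K).

Definition complex_val (S : finSemigroupType) (K : complex S)
  (X : complexT K) : pow S := sval X.

Definition complex_in (S : finSemigroupType) (K : complex S) (X : pow S)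
  (XK : X \in (K : {set pow S})) : complexT K := exist _ X XK.

Lemma complex_valP (S : finSemigroupType) (K : complex S) (X : complexT K) :
  complex_val X \in (K : {set pow S}).
Proof. exact: svalP X. Qed.

Lemma complex_val_inj (S : finSemigroupType) (K : complex S) :
  injective (@complex_val S K).
Proof. exact: val_inj. Qed.

Lemma complex_valM (S : finSemigroupType) (K : complex S) :
  {morph @complex_val S K : X Y / X * Y}.
Proof. by []. Qed.

Lemma down_is_complex (S : finSemigroupType) (D : {set pow S}) :
  mulg_closed D -> sing S \subset down D -> is_complex (down D).
Proof.
move=> cD sD; split=> // [X Y /downP[X' X'D sX] /downP[Y' Y'D sY] | X Y].
  apply/downP; exists (X' * Y'); first exact: cD.
  apply/subsetP => u /pow_mulP[x [y [xX yY ->]]].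
  by apply: in_pow_mul; [apply: (subsetP sX) | apply: (subsetP sY)].
move=> /downP[X' X'D sX] sY; apply/downP; exists X' => //.
exact: subset_trans sX.
Qed.

(* The arrow part of a complex functor is forced to be the restriction of     *)
(* [pow_map], so it is recorded as stability under [pow_map].                 *)
Record complex_functor := ComplexFunctor {
  cf_obj :> forall S : finSemigroupType, complex S;
  cf_map : forall (S T : finSemigroupType) (f : {multiplicative S -> T})
    (X : pow S), X \in (cf_obj S : {set pow S}) ->
    pow_map f X \in (cf_obj T : {set pow T});
  cf_surj : forall (S T : finSemigroupType) (f : {multiplicative S -> T}),
    surjective f -> forall Y : pow T, Y \in (cf_obj T : {set pow T}) ->
    exists2 X : pow S, X \in (cf_obj S : {set pow S}) & pow_map f X = Y
}.

Definition cf_le (C1 C2 : complex_functor) : Prop :=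
  forall S : finSemigroupType,
    (C1 S : {set pow S}) \subset (C2 S : {set pow S}).

Lemma preim_neq0 (S T : finSemigroupType) (f : S -> T) (X : pow S) (Y : pow T) :
  (Y : {set T}) \subset (pow_map f X : {set T}) ->
  [set x in (X : {set S}) | f x \in (Y : {set T})] != set0.
Proof.
move=> sY; have /set0Pn[y yY] := pow_neq0 Y.
have /imsetP[x xX yE] := subsetP sY _ yY.
by apply/set0Pn; exists x; rewrite inE xX -yE.
Qed.

Lemma pow_lift (S T : finSemigroupType) (f : S -> T) (X : pow S) (Y : pow T) :
  (Y : {set T}) \subset (pow_map f X : {set T}) ->
  exists2 X' : pow S, (X' : {set S}) \subset (X : {set S}) & pow_map f X' = Y.
Proof.
move=> sY; exists (Pow (preim_neq0 sY)) => /=.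
  by apply/subsetP => x; rewrite inE => /andP[].
apply: powE; apply/setP => y; apply/imsetP/idP => /= [[x]|yY].
  by rewrite inE => /andP[_ xY] ->.
have /imsetP[x xX yE] := subsetP sY _ yY.
by exists x => //; rewrite inE xX -yE.
Qed.

Lemma big_union_neq0 (S : finSemigroupType) (K : complex S)
  (A : pow (complexT K)) :
  \bigcup_(X in (A : {set complexT K})) (complex_val X : {set S}) != set0.
Proof.
have /set0Pn[X XA] := pow_neq0 A; have /set0Pn[x xX] := pow_neq0 (complex_val X).
by apply/set0Pn; exists x; apply/bigcupP; exists X.
Qed.

Definition big_union (S : finSemigroupType) (K : complex S)
  (A : pow (complexT K)) : pow S := Pow (big_union_neq0 A).

(* [cf_step] is the passage from C^[n](S) to C^[n+1](S); C^[n] is [cf_iter C n] *)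
(* and C^oo is [completion C].                                                 *)
Definition cf_step_set (C : complex_functor) (S : finSemigroupType)
  (K : complex S) : {set pow S} :=
  down [set big_union A | A in (C (complexT K) : {set pow (complexT K)})].

Lemma big_unionM (S : finSemigroupType) (K : complex S)
  (A B : pow (complexT K)) : big_union (A * B) = big_union A * big_union B.
Proof.
apply: powE; apply/setP => u; apply/bigcupP/pow_mulP => /=.
  case=> _ /pow_mulP[X [Y [XA YB ->]]] ; rewrite complex_valM.
  move=> /pow_mulP[x [y [xX yY ->]]]; exists x, y; split=> //.
    by apply/bigcupP; exists X.
  by apply/bigcupP; exists Y.
case=> x [y [/bigcupP[X XA xX] /bigcupP[Y YB yY] ->]].
exists (X * Y); first exact: in_pow_mul.
by rewrite complex_valM; apply: in_pow_mul.
Qed.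

Lemma big_union1 (S : finSemigroupType) (K : complex S) (X : complexT K) :
  big_union (pow1 X) = complex_val X.
Proof. by apply: powE; rewrite /= big_set1. Qed.

Lemma sub_cf_step (C : complex_functor) (S : finSemigroupType)
  (K : complex S) : (K : {set pow S}) \subset cf_step_set C K.
Proof.
apply/subsetP => X XK; apply: (subsetP (sub_down _)); apply/imsetP.
exists (pow1 (complex_in XK)); last by rewrite big_union1.
exact: (subsetP (complex_sing (complexP (C (complexT K)))) _ (in_sing _)).
Qed.

Lemma cf_step_is_complex (C : complex_functor) (S : finSemigroupType)
  (K : complex S) : is_complex (cf_step_set C K).
Proof.
apply: down_is_complex.
  move=> _ _ /imsetP[A AC ->] /imsetP[B BC ->]; rewrite -big_unionM.
  by apply: imset_f; apply: (complex_closed (complexP _)).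
exact: subset_trans (complex_sing (complexP K)) (sub_cf_step C K).
Qed.

Definition cf_step (C : complex_functor) (S : finSemigroupType)
  (K : complex S) : complex S := Complex (cf_step_is_complex C K).

Lemma sing_is_complex (S : finSemigroupType) : is_complex (sing S).
Proof.
split=> // [_ _ /imsetP[x _ ->] /imsetP[y _ ->]|].
  by rewrite pow1M in_sing.
move=> _ Y /imsetP[x _ ->]; rewrite subset1 (negPf (pow_neq0 Y)) orbF.
by move=> /eqP YE; rewrite (_ : Y = pow1 x) ?in_sing //; apply: powE.
Qed.

Definition sing_complex (S : finSemigroupType) : complex S :=
  Complex (sing_is_complex S).

Definition cf_iter (C : complex_functor) (n : nat) (S : finSemigroupType) :
  complex S := iter n (@cf_step C S) (sing_complex S).

Definition completion_set (C : complex_functor) (S : finSemigroupType) :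
  {set pow S} :=
  [set X : pow S | `[< exists n, X \in (cf_iter C n S : {set pow S}) >]].

Lemma completionP (C : complex_functor) (S : finSemigroupType) (X : pow S) :
  reflect (exists n, X \in (cf_iter C n S : {set pow S}))
          (X \in completion_set C S).
Proof. by rewrite inE; apply: asboolP. Qed.

Lemma cf_iter_mono (C : complex_functor) (S : finSemigroupType) m n :
  (m <= n)%N ->
  (cf_iter C m S : {set pow S}) \subset (cf_iter C n S : {set pow S}).
Proof.
move/subnKC <-; elim: (n - m)%N => [|k IHk]; first by rewrite addn0.
by rewrite addnS; apply: subset_trans IHk _; apply: sub_cf_step.
Qed.

Lemma completion_is_complex (C : complex_functor) (S : finSemigroupType) :
  is_complex (completion_set C S).
Proof.
split=> [X Y /completionP[m Xm] /completionP[n Yn]||X Y /completionP[n Xn] sY].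
- apply/completionP; exists (maxn m n).
  apply: (complex_closed (complexP _)).
    by apply: (subsetP (cf_iter_mono C S (leq_maxl m n))).
  by apply: (subsetP (cf_iter_mono C S (leq_maxr m n))).
- by apply/subsetP => X XS; apply/completionP; exists 0%N.
- by apply/completionP; exists n; apply: complex_down sY; first exact: complexP.
Qed.

Lemma cf_iter_map (C : complex_functor) n (S T : finSemigroupType)
  (f : {multiplicative S -> T}) (X : pow S) :
  X \in (cf_iter C n S : {set pow S}) ->
  pow_map f X \in (cf_iter C n T : {set pow T}).
Proof.
elim: n X => [|n IHn] X; first by case/imsetP=> x _ ->; rewrite pow_map1 in_sing.
case/downP=> _ /imsetP[A AC ->] sX; apply/downP.
pose g (Z : complexT (cf_iter C n S)) : complexT (cf_iter C n T) :=
  complex_in (IHn _ (complex_valP Z)).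
have gM : {morph g : Y Z / Y * Z}.
  by move=> Y Z; apply: complex_val_inj; rewrite complex_valM -gmulfM.
pose G : {multiplicative _ -> _} :=
  HB.pack g (isMultiplicative.Build _ _ g gM).
exists (big_union (pow_map G A)); first by apply: imset_f; apply: cf_map.
apply/subsetP => _ /imsetP[x /(subsetP sX) /bigcupP[Z ZA xZ] ->].
by apply/bigcupP; exists (g Z); [apply: imset_f | apply: imset_f].
Qed.

Lemma cf_iter_surj (C : complex_functor) n (S T : finSemigroupType)
  (f : {multiplicative S -> T}) : surjective f ->
  forall Y : pow T, Y \in (cf_iter C n T : {set pow T}) ->
  exists2 X : pow S, X \in (cf_iter C n S : {set pow S}) & pow_map f X = Y.
Proof.
move=> fS; elim: n => [|n IHn] Y.
  case/imsetP=> y _ ->; have [x <-] := fS y.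
  by exists (pow1 x); rewrite ?pow_map1 ?in_sing.
case/downP=> _ /imsetP[B BC ->] sY.
pose g (Z : complexT (cf_iter C n S)) : complexT (cf_iter C n T) :=
  complex_in (cf_iter_map f (complex_valP Z)).
have gM : {morph g : U Z / U * Z}.
  by move=> U Z; apply: complex_val_inj; rewrite complex_valM -gmulfM.
pose G : {multiplicative _ -> _} :=
  HB.pack g (isMultiplicative.Build _ _ g gM).
have GS : surjective G.
  case=> Z Zn; have [X Xn XZ] := IHn _ Zn.
  by exists (complex_in Xn); apply: complex_val_inj.
have [A AC AB] := cf_surj GS BC.
have /pow_lift[X sX XY] :
    (Y : {set T}) \subset (pow_map f (big_union A) : {set T}).
  apply: subset_trans sY _; apply/subsetP => y /bigcupP[Z].
  rewrite -AB => /imsetP[U UA ->] /imsetP[x xU ->].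
  by apply: imset_f; apply/bigcupP; exists U.
by exists X => //; apply/downP; exists (big_union A) => //; apply: imset_f.
Qed.

Definition completion (C : complex_functor) : complex_functor.
Proof.
refine (@ComplexFunctor (fun S => Complex (completion_is_complex C S)) _ _).
  move=> S T f X /completionP[n Xn]; apply/completionP; exists n.
  exact: cf_iter_map.
move=> S T f fS Y /completionP[n Yn]; have [X Xn XY] := cf_iter_surj fS Yn.
by exists X => //; apply/completionP; exists n.
Defined.

(* An arbitrary set of subsets of [S] is a [{set pow S}], classically: [S] is *)
(* finite and [`[< _ >]] turns propositions into booleans.                    *)
Record modulus := Modulus {
  mod_obj :> forall S : finSemigroupType, {set pow S};
  mod_map : forall (S T : finSemigroupType) (f : {multiplicative S -> T})
    (X : pow S), X \in mod_obj S ->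
    exists2 X' : pow T,
      X' \in mod_obj T & (pow_map f X : {set T}) \subset (X' : {set T});
  mod_surj : forall (S T : finSemigroupType) (f : {multiplicative S -> T}),
    surjective f -> forall Y : pow T, Y \in mod_obj T ->
    exists2 Y' : pow S, Y' \in mod_obj S & pow_map f Y' = Y
}.

Definition pt (L : modulus) (S : finSemigroupType) : Prop :=
  L S \subset sing S.

Definition mod_gen (L : modulus) (S : finSemigroupType) : {set pow S} :=
  generated (L S :|: sing S).

Lemma mod_is_complex (L : modulus) (S : finSemigroupType) :
  is_complex (down (mod_gen L S)).
Proof.
apply: down_is_complex; first exact: generated_closed.
apply: subset_trans (sub_down _); apply: subset_trans (sub_generated _).
exact: subsetUr.
Qed.

Lemma mod_gen_map (L : modulus) (S T : finSemigroupType)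
  (f : {multiplicative S -> T}) (X : pow S) :
  X \in mod_gen L S -> pow_map f X \in down (mod_gen L T).
Proof.
pose D := [set Z | pow_map f Z \in down (mod_gen L T)].
have inD Z : (Z \in D) = (pow_map f Z \in down (mod_gen L T)).
  by rewrite /D in_set.
suff /subsetP H : mod_gen L S \subset D by move/H; rewrite inD.
apply: generated_min => [|Y Z]; last first.
  by rewrite !inD gmulfM; apply: (complex_closed (mod_is_complex L T)).
apply/subsetP => Y; rewrite in_setU inD => /orP[YL|/imsetP[x _ ->]].
  have [Y' Y'L sY] := mod_map f YL; apply/downP; exists Y' => //.
  by apply: (subsetP (sub_generated _)); rewrite inE Y'L.
rewrite pow_map1.
exact: (subsetP (complex_sing (mod_is_complex L T)) _ (in_sing _)).
Qed.

Lemma mod_gen_surj (L : modulus) (S T : finSemigroupType)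
  (f : {multiplicative S -> T}) : surjective f ->
  mod_gen L T \subset [set pow_map f X | X in mod_gen L S].
Proof.
move=> fS; apply: generated_min; last first.
  move=> _ _ /imsetP[X XL ->] /imsetP[Y YL ->]; rewrite -gmulfM.
  by apply: imset_f; apply: generated_closed.
apply/subsetP => Y; rewrite inE => /orP[YL|/imsetP[y _ ->]].
  have [X XL <-] := mod_surj fS YL; apply: imset_f.
  by apply: (subsetP (sub_generated _)); rewrite inE XL.
have [x <-] := fS y; rewrite -pow_map1; apply: imset_f.
by apply: (subsetP (sub_generated _)); rewrite inE in_sing orbT.
Qed.

Definition cf_of_modulus (L : modulus) : complex_functor.
Proof.
refine (@ComplexFunctor (fun S => Complex (mod_is_complex L S)) _ _).
  move=> S T f X /downP[X' /(mod_gen_map f) X'L sX].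
  by apply: (complex_down (mod_is_complex L T) X'L); apply: imsetS.
move=> S T f fS Y /downP[Y' /(subsetP (mod_gen_surj L fS)) /imsetP[X XL ->] sY].
have [X' sX XY] := pow_lift sY.
by exists X' => //; apply/downP; exists X.
Defined.

Record relmor (S T : finSemigroupType) := Relmor {
  graph :> subsemigroup (S * T)%type;
  graph_onto : forall s : S, exists t : T, (s, t) \in (graph : {set S * T})
}.

Definition relmor_inv (S T : finSemigroupType) (rho : relmor S T) (t : T) :
  {set S} := [set s | (s, t) \in (rho : {set S * T})].

Definition nerve (S T : finSemigroupType) (rho : relmor S T) : {set pow S} :=
  [set X : pow S | [exists t : T, (X : {set S}) \subset relmor_inv rho t]].

Lemma nerveP (S T : finSemigroupType) (rho : relmor S T) (X : pow S) :
  reflect (exists t : T, (X : {set S}) \subset relmor_inv rho t)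
          (X \in nerve rho).
Proof. by rewrite inE; apply: existsP. Qed.

(* [I] may be empty in [pv_prod] (giving the trivial semigroup), and [H] may  *)
(* be empty in [pv_sub]. Closure under isomorphism is a case of [pv_quot].    *)
Record pseudovariety := Pseudovariety {
  pv_pred :> finSemigroupType -> Prop;
  pv_sub : forall (S : finSemigroupType) (H : subsemigroup S),
    pv_pred S -> pv_pred (subsgT H);
  pv_quot : forall (S T : finSemigroupType) (f : {multiplicative S -> T}),
    surjective f -> pv_pred S -> pv_pred T;
  pv_prod : forall (I : finType) (F : I -> finSemigroupType),
    (forall i, pv_pred (F i)) -> pv_pred (prodsg F)
}.

Definition PL_set (V : pseudovariety) (S : finSemigroupType) : {set pow S} :=
  [set X : pow S | `[< forall T : finSemigroupType, V T ->
                       forall rho : relmor S T, X \in nerve rho >]].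

Lemma PLP (V : pseudovariety) (S : finSemigroupType) (X : pow S) :
  reflect (forall T : finSemigroupType, V T ->
           forall rho : relmor S T, X \in nerve rho)
          (X \in PL_set V S).
Proof. by rewrite inE; apply: asboolP. Qed.

Lemma PL_is_complex (V : pseudovariety) (S : finSemigroupType) :
  is_complex (PL_set V S).
Proof.
split=> [X Y /PLP XV /PLP YV||X Y /PLP XV sY].
- apply/PLP => T VT rho.
  have /nerveP[t sX] := XV T VT rho; have /nerveP[u sY] := YV T VT rho.
  apply/nerveP; exists (t * u); apply/subsetP => _ /pow_mulP[x [y [xX yY ->]]].
  have := subsetP sX _ xX; have := subsetP sY _ yY; rewrite !inE => yu xt.
  exact: (subsgP xt yu).
- apply/subsetP => _ /imsetP[x _ ->]; apply/PLP => T VT rho; apply/nerveP.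
  by have [t xt] := graph_onto rho x; exists t; rewrite sub1set inE.
- apply/PLP => T VT rho; have /nerveP[t sX] := XV T VT rho.
  by apply/nerveP; exists t; apply: subset_trans sX.
Qed.

Lemma PL_map (V : pseudovariety) (S T : finSemigroupType)
  (f : {multiplicative S -> T}) (X : pow S) :
  X \in PL_set V S -> pow_map f X \in PL_set V T.
Proof.
move=> /PLP XV; apply/PLP => W VW rho.
pose G := [set p : S * W | (f p.1, p.2) \in (rho : {set T * W})].
have Gc : mulg_closed G.
  by move=> [x u] [y v]; rewrite !inE /= gmulfM => xu yv; apply: (subsgP xu yv).
have Go s : exists t, (s, t) \in (Subsemigroup Gc : {set S * W}).
  by have [t st] := graph_onto rho (f s); exists t; rewrite inE.
have /nerveP[t sX] := XV W VW (Relmor Go).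
apply/nerveP; exists t; apply/subsetP => _ /imsetP[x xX ->].
by have := subsetP sX _ xX; rewrite !inE.
Qed.

Lemma PL_attained (V : pseudovariety) (S : finSemigroupType) :
  exists (T : finSemigroupType) (rho : relmor S T),
    V T /\ nerve rho \subset PL_set V S.
Proof.
pose I : finType := {X : pow S | X \notin PL_set V S}.
have H (i : I) : exists p : {T : finSemigroupType & relmor S T},
    V (projT1 p) /\ val i \notin nerve (projT2 p).
  have nV : ~ forall T : finSemigroupType, V T ->
      forall rho : relmor S T, val i \in nerve rho.
    by move/PLP => iV; have /negP := valP i; apply.
  case/existsNP: nV => T /not_implyP[VT] /existsNP[rho /negP nX].
  by exists (existT _ T rho).
pose F i := projT1 (sval (cid (H i))).
pose r i : relmor S (F i) := projT2 (sval (cid (H i))).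
have FV i : V (F i) by case: (svalP (cid (H i))).
have rN i : val i \notin nerve (r i) by case: (svalP (cid (H i))).
pose G := [set p : S * prodsg F |
           [forall i, (p.1, p.2 i) \in (r i : {set S * F i})]].
have Gc : mulg_closed G.
  move=> [x u] [y v]; rewrite !inE /= => /forallP xu /forallP yv.
  by apply/forallP => i; rewrite ffunE; apply: (subsgP (xu i) (yv i)).
have Go s : exists t, (s, t) \in (Subsemigroup Gc : {set S * prodsg F}).
  have t i := cid (graph_onto (r i) s).
  exists [ffun i => sval (t i)]; rewrite inE; apply/forallP => i /=.
  by rewrite ffunE; apply: svalP (t i).
exists (prodsg F), (Relmor Go); split; first exact: pv_prod.
apply/subsetP => X /nerveP[t sX]; apply: contraT => nX.
case/negP: (rN (exist _ X nX)); apply/nerveP; exists (t (exist _ X nX)).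
apply/subsetP => x /(subsetP sX); rewrite !inE => /forallP.
exact.
Qed.

Lemma PL_surj (V : pseudovariety) (S T : finSemigroupType)
  (f : {multiplicative S -> T}) : surjective f ->
  forall Y : pow T, Y \in PL_set V T ->
  exists2 X : pow S, X \in PL_set V S & pow_map f X = Y.
Proof.
move=> fS Y /PLP YV; have [W [rho [VW /subsetP rN]]] := PL_attained V S.
pose G := [set (f p.1, p.2) | p in (rho : {set S * W})].
have Gc : mulg_closed G.
  move=> _ _ /imsetP[[x u] xu ->] /imsetP[[y v] yv ->]; apply/imsetP.
  by exists (x * y, u * v); [apply: (subsgP xu yv) | rewrite /= gmulfM].
have Go s : exists t, (s, t) \in (Subsemigroup Gc : {set T * W}).
  have [x <-] := fS s; have [t xt] := graph_onto rho x.
  by exists t; apply/imsetP; exists (x, t).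
have /nerveP[t sY] := YV W VW (Relmor Go).
have lift y : y \in (Y : {set T}) ->
    exists2 x, x \in relmor_inv rho t & f x = y.
  move/(subsetP sY); rewrite inE => /imsetP[[x u] xu [-> ->]].
  by exists x; rewrite ?inE.
have ne0 : relmor_inv rho t != set0.
  have /set0Pn[y /lift[x xt _]] := pow_neq0 Y.
  by apply/set0Pn; exists x.
have /pow_lift[X sX XY] :
    (Y : {set T}) \subset (pow_map f (Pow ne0) : {set T}).
  by apply/subsetP => y /lift[x xt <-]; apply: imset_f.
by exists X => //; apply: rN; apply/nerveP; exists t.
Qed.

Definition PL (V : pseudovariety) : complex_functor :=
  @ComplexFunctor (fun S => Complex (PL_is_complex V S)) (@PL_map V)
    (@PL_surj V).

(* Main.v *)
Require Import Defs.
From HB Require Import structures.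
From mathcomp Require Import all_boot.

(** If every semigroup of V is a point of L and rho is a relational morphism
    from S to some T in V, then the nerve of rho absorbs each step of the
    completion. The graph R of rho projects onto S and maps to T, so a member
    of L S lifts to a member of L R, whose image in T lies in a member of L T,
    hence is a singleton {t}; read in R, this says that the given set lies in
    rho^-1(t). Since a nerve is a complex, it therefore contains all of C_L(S)
    ([cf_of_modulus_sub_nerve]).

    For the next steps, let K be a complex contained in the nerve of rho. Then
    rho induces a relational morphism from the semigroup K to the same T,
    relating X to t when X lies in rho^-1(t) ([relmor_complex]). The first
    paragraph, applied to it, says that the members of any A in C_L(K) share a
    common t, so the union of A lies in rho^-1(t) ([cf_step_sub_nerve]). By
    induction the whole completion lies in the nerve, for every rho.

    Conversely C_L lies below its completion ([cf_le_completion]), and on a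
    semigroup of V the identity is a relational morphism to V whose nerve
    consists of singletons ([nerve_id]). *)

Set Implicit Arguments.
Unset Strict Implicit.
Unset Printing Implicit Defensive.

Local Open Scope group_scope.

Section Projections.

Variables (S T : finSemigroupType) (rho : relmor S T).

Definition graph_fst (p : subsgT rho) : S := (val p).1.
Definition graph_snd (p : subsgT rho) : T := (val p).2.

Lemma graph_fstM : {morph graph_fst : p q / p * q}.
Proof. by []. Qed.

Lemma graph_sndM : {morph graph_snd : p q / p * q}.
Proof. by []. Qed.

HB.instance Definition _ :=
  isMultiplicative.Build (subsgT rho) S graph_fst graph_fstM.
HB.instance Definition _ :=
  isMultiplicative.Build (subsgT rho) T graph_snd graph_sndM.

Lemma graph_fst_surj : surjective graph_fst.
Proof. by move=> s; have [t st] := graph_onto rho s; exists (exist _ (s, t) st). Qed.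

End Projections.

Lemma nerve_is_complex (S T : finSemigroupType) (rho : relmor S T) :
  is_complex (nerve rho).
Proof.
split=> [X Y /nerveP[t sX] /nerveP[u sY]||X Y /nerveP[t sX] sY].
- apply/nerveP; exists (t * u); apply/subsetP => _ /pow_mulP[x [y [xX yY ->]]].
  have := subsetP sY _ yY; have := subsetP sX _ xX; rewrite !inE => xt yu.
  exact: (subsgP xt yu).
- apply/subsetP => _ /imsetP[x _ ->]; apply/nerveP.
  by have [t xt] := graph_onto rho x; exists t; rewrite sub1set inE.
- by apply/nerveP; exists t; apply: subset_trans sX.
Qed.

Lemma relmor_id_closed (S : finSemigroupType) :
  mulg_closed [set p : S * S | p.1 == p.2].
Proof. by move=> [x u] [y v]; rewrite !inE /= => /eqP-> /eqP->. Qed.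

Lemma relmor_id_onto (S : finSemigroupType) (s : S) :
  exists t, (s, t) \in (Subsemigroup (@relmor_id_closed S) : {set S * S}).
Proof. by exists s; rewrite inE. Qed.

Definition relmor_id (S : finSemigroupType) : relmor S S :=
  Relmor (@relmor_id_onto S).

Lemma nerve_id (S : finSemigroupType) : nerve (relmor_id S) \subset sing S.
Proof.
apply/subsetP => X /nerveP[t sX].
apply: (complex_down (sing_is_complex S) (in_sing t)).
by apply: subset_trans sX _; apply/subsetP => x; rewrite !inE.
Qed.

Section Lift.

Variables (S T : finSemigroupType) (rho : relmor S T) (K : complex S).
Hypothesis KN : (K : {set pow S}) \subset nerve rho.

Lemma relmor_complex_closed :
  mulg_closed [set p : complexT K * T |
                (complex_val p.1 : {set S}) \subset relmor_inv rho p.2].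
Proof.
move=> [X t] [Y u]; rewrite !inE /= => sX sY.
apply/subsetP => _ /pow_mulP[x [y [xX yY ->]]].
have := subsetP sY _ yY; have := subsetP sX _ xX; rewrite !inE => xt yu.
exact: (subsgP xt yu).
Qed.

Lemma relmor_complex_onto (X : complexT K) :
  exists t, (X, t) \in
    (Subsemigroup relmor_complex_closed : {set complexT K * T}).
Proof.
have /nerveP[t sX] := subsetP KN _ (complex_valP X).
by exists t; rewrite inE.
Qed.

(** Projecting onto K is exactly the hypothesis that K lies in the nerve. *)
Definition relmor_complex : relmor (complexT K) T := Relmor relmor_complex_onto.

Lemma big_union_nerve (A : pow (complexT K)) :
  A \in nerve relmor_complex -> big_union A \in nerve rho.
Proof.
move=> /nerveP[t sA]; apply/nerveP; exists t; apply/bigcupsP => X XA.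
by have := subsetP sA _ XA; rewrite !inE.
Qed.

End Lift.

(** Lift X along the surjection from the graph of rho to S, then push the lift
    to T, where it is contained in a singleton. *)
Lemma modulus_sub_nerve (L : modulus) (S T : finSemigroupType)
  (rho : relmor S T) : pt L T -> L S \subset nerve rho.
Proof.
move=> /subsetP ptT; apply/subsetP => X XL.
have [Z ZL <-] := mod_surj (@graph_fst_surj _ _ rho) XL.
have [Y /ptT /imsetP[t _ ->] /subsetP sZ] := mod_map (@graph_snd _ _ rho) ZL.
apply/nerveP; exists t; apply/subsetP => _ /imsetP[p pZ ->]; rewrite inE.
have /sZ/set1P <- := imset_f (@graph_snd _ _ rho) pZ.
by rewrite -surjective_pairing; apply: valP.
Qed.

Lemma cf_of_modulus_sub_nerve (L : modulus) (S T : finSemigroupType)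
  (rho : relmor S T) :
  pt L T -> (cf_of_modulus L S : {set pow S}) \subset nerve rho.
Proof.
move=> ptT; have NC := nerve_is_complex rho.
apply/subsetP => X /downP[Y YL]; apply: complex_down => //.
apply: subsetP Y YL; apply: generated_min; last exact: complex_closed NC.
by rewrite subUset modulus_sub_nerve //; apply: complex_sing.
Qed.

Lemma cf_step_sub_nerve (L : modulus) (S T : finSemigroupType)
  (rho : relmor S T) (K : complex S) :
  pt L T -> (K : {set pow S}) \subset nerve rho ->
  (cf_step (cf_of_modulus L) K : {set pow S}) \subset nerve rho.
Proof.
move=> ptT KN; apply/subsetP => X /downP[_ /imsetP[A AC ->]].
apply: (complex_down (nerve_is_complex rho)).
apply: (big_union_nerve (KN := KN)).
exact: (subsetP (cf_of_modulus_sub_nerve (relmor_complex KN) ptT)).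
Qed.

(** A subset X of S is the union of the set of singletons of its elements, so
    C(S) already appears in the first step of the completion. *)
Lemma cf_le_completion (C : complex_functor) : cf_le C (completion C).
Proof.
move=> S; apply/subsetP => X XC; apply/completionP; exists 1%N.
pose g (x : S) : complexT (sing_complex S) :=
  complex_in (in_sing x : pow1 x \in (sing_complex S : {set pow S})).
have gM : {morph g : x y / x * y}.
  by move=> x y; apply: complex_val_inj; rewrite complex_valM /= pow1M.
pose G : {multiplicative _ -> _} :=
  HB.pack g (isMultiplicative.Build _ _ g gM).
apply/downP; exists (big_union (pow_map G X)); first by apply/imset_f/cf_map.
apply/subsetP => x xX; apply/bigcupP; exists (g x); first exact: imset_f.
by rewrite inE.
Qed.

Theorem mainTheorem4 (V : pseudovariety) (L : modulus) :
  (forall S : finSemigroupType, V S -> pt L S) <->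
  cf_le (completion (cf_of_modulus L)) (PL V).
Proof.
split=> [ptV S | leC S VS].
  apply/subsetP => X /completionP[n XCn]; apply/PLP => T /ptV ptT rho.
  apply: subsetP X XCn; elim: n => [|n IHn]; last exact: cf_step_sub_nerve.
  exact: complex_sing (nerve_is_complex rho).
apply/subsetP => X XL; apply: (subsetP (nerve_id S)).
have XC : X \in (cf_of_modulus L S : {set pow S}).
  apply/(subsetP (sub_down _))/(subsetP (sub_generated _)).
  by rewrite inE XL.
by have /(subsetP (leC S))/PLP := subsetP (cf_le_completion _ _) _ XC; apply.
Qed.
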